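(* Let $0\le k\le n-2$. Every positroid tiling of the hypersimplex $\Delta_{k+1,n}$ consists of exactly $\binom{n-2}{k}$ tiles.
   Context: For $x\in\mathbb R^n$ and $S\subseteq[n]$ write $x_S=\sum_{i\in S}x_i$; for $i\ne j$ in $[n]$, $[i,j]=\{i,i+1,\dots,j\}$ is the cyclic interval (indices mod $n$). The hypersimplex is $\Delta_{k+1,n}=\mathrm{conv}\{e_I : I\in\binom{[n]}{k+1}\}\subset\mathbb R^n$, where $e_I=\sum_{i\in I}e_i$. Let $\mathbf P_n$ be a convex $n$-gon with vertices labeled $1,\dots,n$ clockwise. A bicolored subdivision $\sigma$ of $\mathbf P_n$ is a partition of $\mathbf P_n$ into polygons (with vertices among those of $\mathbf P_n$) colored black or white so that two polygons sharing an edge have different colors; it has type $(k,n)$ if any triangulation of its black polygons has exactly $k$ triangles. For vertices $i\neq j$, the arc $i\to j$ is compatible with $\sigma$ if the chord $(i,j)$ is an edge of a polygon of $\sigma$ or lies inside a polygon of $\sigma$; the region to the left of $i\to j$ is the part of $\mathbf P_n$ cut off by the chord $(i,j)$ that contains the vertices $i+1,\dots,j-1$; for compatible $i\to j$, $\mathrm{area}(i\to j)$ is the number of black triangles to the left of $i\to j$ in any triangulation of the black polygons. For $\sigma$ of type $(k,n)$, the positroid tile $\Gamma_\sigma\subset\mathbb R^n$ is $\{x: x_{[n]}=k+1,\ \mathrm{area}(i\to j)\le x_{[i,j-1]}\le \mathrm{area}(i\to j)+1 \text{ for all compatible arcs } i\to j\}$. (These are exactly the closures of moment-map images of $(n-1)$-dimensional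 positroid cells of $\mathrm{Gr}^{\ge0}_{k+1,n}$ on which the moment map is injective.) A positroid tiling of $\Delta_{k+1,n}$ is a collection of such tiles $\Gamma_\sigma$ with pairwise disjoint interiors whose union is $\Delta_{k+1,n}$. *)

(* Defs.v *)
From HB Require Import structures.
From mathcomp Require Import all_boot all_order all_algebra.
From mathcomp Require Import all_classical all_reals all_analysis.

Set Implicit Arguments.
Unset Strict Implicit.
Unset Printing Implicit Defensive.

Import Order.TTheory GRing.Theory Num.Theory.
Import numFieldNormedType.Exports.

(* The vertices 1, ..., n of the convex n-gon are the elements 0, ..., n-1 of
   'I_n, in clockwise order; a polygon is given by its set of vertices. *)

Section Polygons.
Context {n : nat}.
Implicit Types (i j v : 'I_n) (S A B t : {set 'I_n}) (F T : {set {set 'I_n}}).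

(* [i, j] = {i, i+1, ..., j} modulo n: the vertices met going clockwise from i
   no later than j; [i, i] = {i}. *)
Definition cyc_itv i j : {set 'I_n} :=
  [set v : 'I_n | (v + (n - i)) %% n <= (j + (n - i)) %% n]%SET.

(* The partitions F of the convex polygon S into polygons with vertices in S.
   Such a partition is obtained by cutting repeatedly along diagonals (i, j),
   those chords having a vertex of S strictly on either side.  The segment
   (#|S| = 2) counts as an indivisible degenerate polygon; it occurs only as
   the whole "2-gon" when n = 2. *)
Inductive dissection : {set 'I_n} -> {set {set 'I_n}} -> Prop :=
| dissection_whole S : 2 <= #|S| -> dissection S [set S]%SET
| dissection_cut S i j F1 F2 :
    i \in S -> j \in S -> i != j ->
    2 < #|S :&: cyc_itv i j| -> 2 < #|S :&: cyc_itv j i| ->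
    dissection (S :&: cyc_itv i j) F1 ->
    dissection (S :&: cyc_itv j i) F2 ->
    dissection S (F1 :|: F2).

Definition polygon_edge S i j : Prop :=
  [/\ i \in S, j \in S, i != j &
      S :&: cyc_itv i j = [set i; j]%SET \/ S :&: cyc_itv j i = [set i; j]%SET].

Definition share_edge A B : Prop :=
  exists i j, polygon_edge A i j /\ polygon_edge B i j.

Definition triangulation S T : Prop :=
  dissection S T /\ (forall t, t \in T -> #|t| <= 3).

Definition triangles T : {set {set 'I_n}} := [set t in T | #|t| == 3]%SET.

End Polygons.

Record bicolored_subdivision (n : nat) := BicoloredSubdivision {
  black : {set {set 'I_n}};
  white : {set {set 'I_n}};
  black_white_disjoint : [disjoint black & white];
  bicolored_dissection : dissection [set: 'I_n]%SET (black :|: white);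
  bicolored_adjacent : forall A B : {set 'I_n},
    A \in black :|: white -> B \in black :|: white -> A != B ->
    share_edge A B -> (A \in black) != (B \in black)
}.

Section Subdivisions.
Context {n : nat} (sigma : bicolored_subdivision n).
Implicit Types (i j : 'I_n) (T : {set {set 'I_n}}).

Definition black_triangulation T : Prop :=
  exists2 tr : {set 'I_n} -> {set {set 'I_n}},
    (forall B, B \in black sigma -> triangulation B (tr B)) &
    T = (\bigcup_(B in black sigma) tr B)%SET.

Definition has_type (k : nat) : Prop :=
  forall T, black_triangulation T -> #|triangles T| = k.

(* A chord whose two endpoints are vertices of the convex polygon A is either
   an edge of A or lies inside A. *)
Definition compatible_arc i j : Prop :=
  i != j /\
  exists2 A : {set 'I_n}, A \in black sigma :|: white sigma &
                          i \in A /\ j \in A.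

Definition chord_avoids T i j : Prop :=
  forall t, t \in T -> t \subset cyc_itv i j \/ t \subset cyc_itv j i.

(* When the chord (i, j) lies inside a black polygon, only the triangulations
   that it does not cut through split into a left and a right part. *)
Definition is_area i j (a : nat) : Prop :=
  forall T, black_triangulation T -> chord_avoids T i j ->
    #|[set t in triangles T | t \subset cyc_itv i j]%SET| = a.

End Subdivisions.

Local Open Scope ring_scope.
Local Open Scope classical_set_scope.

Section Hypersimplex.
Context {R : realType}.

Definition coord_sum {n : nat} (x : 'rV[R]_n) (S : {set 'I_n}) : R :=
  \sum_(i in S) x ord0 i.

Definition indicator_vec {n : nat} (I : {set 'I_n}) : 'rV[R]_n :=
  \row_i (i \in I)%:R.

(* The convex hull of the vectors e_I, #|I| = m. *)
Definition hypersimplex {n : nat} (m : nat) : set 'rV[R]_n :=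
  [set x | exists w : {set 'I_n} -> R,
    [/\ forall I : {set 'I_n}, #|I| = m -> 0 <= w I,
        \sum_(I : {set 'I_n} | #|I| == m) w I = 1 &
        x = \sum_(I : {set 'I_n} | #|I| == m) w I *: indicator_vec I]].

Definition tile {n : nat} (k : nat) (sigma : bicolored_subdivision n) :
    set 'rV[R]_n :=
  [set x | coord_sum x [set: 'I_n]%SET = k.+1%:R /\
    forall (i j : 'I_n) (a : nat),
      compatible_arc sigma i j -> is_area sigma i j a ->
      a%:R <= coord_sum x (cyc_itv i (ord_pred j)) <= a%:R + 1].

(* Tiles lie in the hyperplane x_[n] = k+1, so their interiors are taken
   relative to it. *)
Definition tile_interior {n : nat} (k : nat) (G : set 'rV[R]_n) :
    set 'rV[R]_n :=
  let H := [set x : 'rV[R]_n | coord_sum x [set: 'I_n]%SET = k.+1%:R] in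
  [set x | H x /\ \forall y \near x, H y -> G y].

Definition positroid_tiling {n : nat} (k : nat) (T : set (set 'rV[R]_n)) : Prop :=
  [/\ forall G, T G ->
        exists2 sigma : bicolored_subdivision n,
          has_type sigma k & G = tile k sigma,
      trivIset T (tile_interior k) &
      \bigcup_(G in T) G = hypersimplex k.+1].

End Hypersimplex.

(* Main.v *)
Require Import Defs.
From HB Require Import structures.
From mathcomp Require Import all_boot all_order all_algebra.
From mathcomp Require Import all_classical all_reals all_analysis.
From mathcomp Require Import zify ring lra.

(* Order the vertices as 0 < ... < n - 1 and call a vertex of a polygon inner
   if it is neither its first nor its last one.  A triangle has one inner
   vertex, and every dissection shares out the inner vertices of the n-gon among
   its polygons.  So a subdivision sigma of type (k, n) determines the k-set
   B(sigma) of the inner vertices of its black triangles, and area(i -> j) is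
   the number of elements of B(sigma) that are inner in the polygon [i, j].  To
   each k-set S of inner vertices of the n-gon we attach a point p_S of the
   hypersimplex whose sums x_[i,j-1] lie strictly between a and a + 1, where a
   is the number of elements of S that are inner in [i, j].  Hence p_S is in the
   tile of sigma iff S = B(sigma), and then it is an interior point.  In a
   tiling, every p_S is thus in exactly one tile and every tile contains exactly
   one p_S. *)

Set Implicit Arguments.
Unset Strict Implicit.
Unset Printing Implicit Defensive.

Import Order.TTheory GRing.Theory Num.Theory.
Import numFieldNormedType.Exports.

Section Transversals.
Local Open Scope classical_set_scope.

Lemma card_finset_II (I : finType) (D : {set I}) : ([set` D] #= `I_#|D|)%card.
Proof.
have -> : [set` D] = range (enum_val : 'I_#|D| -> I).
  apply/seteqP; split=> [i iD|_ [m _ <-]]; last exact: enum_valP.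
  by exists (enum_rank_in iD i); rewrite ?enum_rankK_in.
by rewrite (card_eql (inj_card_eq (in2W enum_val_inj))) card_esym // card_II.
Qed.

Lemma card_eq_transversal (V : Type) (I : finType) (T : set (set V))
    (D : {set I}) (p : I -> V) (interior : set V -> set V) :
    trivIset T interior ->
    (forall G, T G -> exists i, [/\ i \in D, interior G (p i)
      & forall j, j \in D -> G (p j) -> j = i]) ->
    (forall i, i \in D -> exists2 G, T G & G (p i)) ->
  (T #= `I_#|D|)%card.
Proof.
move=> triv point cover.
have /choice[F FP] i : exists G, i \in D -> T G /\ G (p i).
  by have [/cover[G]|_] := boolP (i \in D); [exists G|exists set0].
have -> : T = F @` [set` D].
  apply/seteqP; split=> [G TG|_ [i /FP[]] TF _ <- //].
  have [i [iD Gi _]] := point G TG; exists i => //; have [TF Fi] := FP i iD.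
  apply: triv => //; exists (p i); split=> //.
  by have [j [_ + unique_j]] := point _ TF; rewrite -(unique_j i iD Fi).
apply: card_eq_trans (card_finset_II D); apply: inj_card_eq => i j.
move=> /set_mem iD /set_mem jD Fij.
have [TFi Fi] := FP i iD; have [_ Fj] := FP j jD; rewrite -Fij in Fj.
have [l [_ _ unique_l]] := point _ TFi.
by rewrite [LHS](unique_l i iD Fi) [RHS](unique_l j jD Fj).
Qed.

End Transversals.

Section CyclicIntervals.
(* all_classical has shadowed the lemmas on finite sets. *)
Import boot.fintype boot.finset.
Local Open Scope set_scope.
Context {n : nat}.
Implicit Types (i j p q v : 'I_n).

Lemma in_cyc_itv i j v :
  (v \in cyc_itv i j) = (i <= v <= j) || (j < i) && ((i <= v) || (v <= j)).
Proof.
have shiftE (w : 'I_n) :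
    (w + (n - i)) %% n = if i <= w then w - i else w + (n - i).
  have := ltn_ord i; have := ltn_ord w => ltwn ltin.
  case: leqP => iw.
    by rewrite (_ : w + (n - i) = (w - i) + n) ?modnDr ?modn_small; lia.
  by rewrite modn_small; lia.
rewrite inE !shiftE; have := ltn_ord i; have := ltn_ord j; have := ltn_ord v.
by case: (leqP i v); case: (leqP i j); lia.
Qed.

Lemma cyc_itvxx i : cyc_itv i i = [set i].
Proof. by apply/setP => v; rewrite in_cyc_itv in_set1 -val_eqE /=; lia. Qed.

Lemma cyc_itvUC i j : i != j -> cyc_itv i j :|: cyc_itv j i = [set: 'I_n].
Proof.
rewrite -val_eqE /= => ij; apply/setP => v.
by rewrite in_setU in_setT !in_cyc_itv; lia.
Qed.

Lemma cyc_itvIC i j : i != j -> cyc_itv i j :&: cyc_itv j i = [set i; j].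
Proof.
rewrite -val_eqE /= => ij; apply/setP => v.
by rewrite in_setI in_set2 !in_cyc_itv -!val_eqE /=; lia.
Qed.

Lemma cyc_itv_noncrossing p q i j : p != q -> i != j ->
    i \in cyc_itv p q -> j \in cyc_itv p q ->
  cyc_itv q p \subset cyc_itv i j \/ cyc_itv q p \subset cyc_itv j i.
Proof.
rewrite -!val_eqE /= !in_cyc_itv => pq ij ipq jpq.
have [|/subsetPn[x]] := boolP (cyc_itv q p \subset cyc_itv i j); first by left.
rewrite !in_cyc_itv => xqp xij; right; apply/subsetP => y.
by rewrite !in_cyc_itv; lia.
Qed.

Lemma val_ordS i : ordS i = (if i.+1 == n then 0 else i.+1) :> nat.
Proof.
have := ltn_ord i; rewrite leq_eqVlt => /predU1P[iE|iltn].
  by rewrite /= iE eqxx modnn.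
by rewrite /= modn_small // ltn_eqF.
Qed.

Lemma neq_ordS i : 1 < n -> i != ordS i.
Proof.
move=> n_gt1; rewrite -(inj_eq (@ord_inj n)) val_ordS.
by case: (i.+1 =P n); lia.
Qed.

Lemma cyc_itv_ordS i : cyc_itv i (ordS i) \subset [set i; ordS i].
Proof.
apply/subsetP => v; rewrite in_set2 in_cyc_itv.
rewrite -!(inj_eq (@ord_inj n)) !val_ordS.
by have := ltn_ord v; case: (i.+1 =P n); lia.
Qed.

Lemma val_ord_pred j :
  ord_pred j = (if j == 0 :> nat then n.-1 else j.-1) :> nat.
Proof.
have := ltn_ord j => /=; case: (nat_of_ord j) => [|m] mn.
  by rewrite modn_small //; lia.
by rewrite addSn /= modnDr modn_small //; lia.
Qed.

Lemma in_cyc_itv_pred i j v : i < j ->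
  (v \in cyc_itv i (ord_pred j)) = (i <= v < j).
Proof.
move=> ij; rewrite in_cyc_itv val_ord_pred.
by have := ltn_ord j; case: eqP; lia.
Qed.

Lemma cyc_itv_predC i j : i != j ->
  cyc_itv j (ord_pred i) = ~: cyc_itv i (ord_pred j).
Proof.
rewrite -val_eqE /= => ij; apply/setP => v.
rewrite in_setC !in_cyc_itv !val_ord_pred.
have := ltn_ord i; have := ltn_ord j; have := ltn_ord v.
by case: eqP; case: eqP; lia.
Qed.

End CyclicIntervals.

Section InnerVertices.
Import boot.fintype boot.finset.
Local Open Scope set_scope.
Context {n : nat}.
Implicit Types (i j v : 'I_n) (S A B : {set 'I_n}).

Definition inner A : {set 'I_n} :=
  [set v in A | [exists a in A, a < v] && [exists c in A, v < c]].

Lemma innerP A v :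
  reflect [/\ v \in A, exists2 a, a \in A & a < v & exists2 c, c \in A & v < c]
          (v \in inner A).
Proof.
rewrite inE; apply: (iffP and3P) => -[vA Aa Ac]; split=> //.
- by have /exists_inP := Aa.
- by have /exists_inP := Ac.
- exact/exists_inP.
- exact/exists_inP.
Qed.

Lemma innerS A B : A \subset B -> inner A \subset inner B.
Proof.
move=> /subsetP sAB; apply/subsetP => v /innerP[vA [a aA av] [c cA vc]].
by apply/innerP; split; [|exists a|exists c]; rewrite ?sAB.
Qed.

Lemma card_inner A : #|inner A| = #|A| - 2.
Proof.
have [->|[x xA]] := set_0Vmem A.
  rewrite cards0; apply/eqP; rewrite cards_eq0 -subset0.
  by apply/subsetP => v /innerP[].
have [a aA amin] := arg_minnP (fun v : 'I_n => v : nat) xA.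
have [c cA cmax] := arg_maxnP (fun v : 'I_n => v : nat) xA.
have -> : inner A = A :\: [set a; c].
  apply/setP => v; rewrite in_setD in_set2 -!val_eqE /=.
  apply/innerP/andP => [[vA [b /amin ? ?] [d /cmax ? ?]]|[vac vA]].
    by split=> //; lia.
  by split=> //; [exists a|exists c] => //;
    have := amin v vA; have := cmax v vA; lia.
have acA : [set a; c] \subset A.
  by apply/subsetP => v; rewrite in_set2 => /orP[] /eqP->.
rewrite cardsD (setIidPr acA) cards2; have [ac|//] := eqVneq a c.
suff : #|A| <= #|[set a]| by rewrite cards1 /=; lia.
apply/subset_leq_card/subsetP => v vA; rewrite in_set1 -val_eqE /=.
by have := amin v vA; have := cmax v vA; rewrite -ac; lia.
Qed.

Lemma in_inner_cut S i j v : i \in S -> j \in S -> i < j ->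
  (v \in inner (S :&: cyc_itv i j)) = (v \in S) && (i < v < j).
Proof.
move=> iS jS ij; apply/innerP/andP => [[]|[vS /andP[iv vj]]].
  rewrite in_setI => /andP[vS _] [a + av] [c + vc].
  by rewrite !in_setI !in_cyc_itv => /andP[_ +] /andP[_ +]; split=> //; lia.
split; first by rewrite in_setI vS in_cyc_itv; lia.
  by exists i; rewrite // in_setI iS in_cyc_itv; lia.
by exists j; rewrite // in_setI jS in_cyc_itv; lia.
Qed.

Lemma inner_cutC S i j : i \in S -> j \in S -> i != j ->
  inner (S :&: cyc_itv j i) = inner S :\: inner (S :&: cyc_itv i j).
Proof.
wlog ij : i j / i < j => [hwlog iS jS neqij|iS jS _].
  have [ij|ji|/val_inj eqij] := ltngtP i j; first exact: hwlog.
    rewrite (hwlog j i) // 1?eq_sym // setDDr setDv set0U.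
    by apply/esym/setIidPr/innerS/subsetIl.
  by rewrite eqij eqxx in neqij.
apply/setP => v; rewrite in_setD (in_inner_cut v iS jS ij).
apply/idP/andP => [vinner|[vij /innerP[vS [a aS av] [c cS vc]]]].
  split; last exact: subsetP (innerS (subsetIl _ _)) _ vinner.
  have /innerP[] := vinner; rewrite in_setI in_cyc_itv => /andP[_ ?] _ _.
  by lia.
rewrite vS /= in vij; apply/innerP; split.
- by rewrite in_setI vS in_cyc_itv; lia.
- have [vi|iv] := leqP v i; [exists a|exists i] => //.
    by rewrite in_setI aS in_cyc_itv; lia.
  by rewrite in_setI iS in_cyc_itv; lia.
- have [jv|vj] := leqP j v; [exists c|exists j] => //.
    by rewrite in_setI cS in_cyc_itv; lia.
  by rewrite in_setI jS in_cyc_itv; lia.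
Qed.

Lemma inner_cutU S i j : i \in S -> j \in S -> i != j ->
  inner (S :&: cyc_itv i j) :|: inner (S :&: cyc_itv j i) = inner S.
Proof.
move=> iS jS ij; rewrite (inner_cutC iS jS ij).
by rewrite -[X in X :|: _](setIidPr (innerS (subsetIl S (cyc_itv i j)))) setID.
Qed.

Lemma inner_cyc_itvC i j : i != j ->
  inner (cyc_itv j i) = inner [set: 'I_n] :\: inner (cyc_itv i j).
Proof.
by move=> /(inner_cutC (in_setT i) (in_setT j)); rewrite !setTI.
Qed.

Lemma inner_cyc_itv_disjoint i j v : i != j ->
  v \in inner (cyc_itv i j) -> v \in inner (cyc_itv j i) -> False.
Proof. by move=> /inner_cyc_itvC ->; rewrite in_setD => ->. Qed.

Lemma in_inner_cyc_itv i j v : i < j ->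
  (v \in inner (cyc_itv i j)) = (i < v < j).
Proof. by move=> ij; rewrite -[cyc_itv i j]setTI in_inner_cut ?in_setT. Qed.

Lemma inner_cyc_itv_ordS i : inner (cyc_itv i (ordS i)) = set0.
Proof.
apply/eqP; rewrite -cards_eq0 card_inner subn_eq0.
apply: leq_trans (subset_leq_card (cyc_itv_ordS i)) _.
by rewrite cards2; case: (_ != _).
Qed.

Definition inner_subsets k : {set {set 'I_n}} :=
  [set S : {set 'I_n} | S \subset inner [set: 'I_n] & #|S| == k].

Lemma inner_subsetsP k S :
  reflect (S \subset inner [set: 'I_n] /\ #|S| = k) (S \in inner_subsets k).
Proof. by rewrite inE; apply: (iffP andP) => -[Ssub /eqP]. Qed.

Lemma card_inner_subsets k : #|inner_subsets k| = 'C(n - 2, k).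
Proof. by rewrite cards_draws card_inner cardsT card_ord. Qed.

End InnerVertices.

Section Dissections.
Import boot.fintype boot.finset.
Local Open Scope set_scope.
Context {n : nat}.
Implicit Types (i j v : 'I_n) (S A B t X Y : {set 'I_n}).
Implicit Types (F T U : {set {set 'I_n}}).

Lemma dissection_sub S F A : dissection S F -> A \in F -> A \subset S.
Proof.
move=> dF; elim: dF A => {S F} [S _ A|S i j F G _ _ _ _ _ _ subF _ subG A].
  by rewrite in_set1 => /eqP->.
by rewrite in_setU => /orP[/subF|/subG]; rewrite subsetI => /andP[].
Qed.

Lemma dissection_setI_sub S X F A : dissection (S :&: X) F -> A \in F ->
  A \subset X.
Proof. by move=> dF /(dissection_sub dF); rewrite subsetI => /andP[]. Qed.

Lemma dissection_card S F A : dissection S F -> A \in F -> 1 < #|A|.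
Proof.
move=> dF.
elim: dF A => {S F} [S cardS A|S i j F G _ _ _ _ _ _ cardF _ cardG A].
  by rewrite in_set1 => /eqP->.
by rewrite in_setU => /orP[/cardF|/cardG].
Qed.

Lemma bigcup_inner_dissection S F : dissection S F ->
  \bigcup_(A in F) inner A = inner S.
Proof.
elim=> {S F} [S _|S i j F G iS jS ij _ _ _ IHF _ IHG].
  by rewrite big_set1.
by rewrite bigcup_setU IHF IHG inner_cutU.
Qed.

Definition disjoint_inner F : Prop :=
  forall v, {in F &, forall A B, v \in inner A -> v \in inner B -> A = B}.

Lemma dissection_disjoint_inner S F : dissection S F -> disjoint_inner F.
Proof.
move=> dF v.
elim: dF => {S F} [S _ A B|S i j F G iS jS ij _ _ dF IHF dG IHG A B].
  by rewrite !in_set1 => /eqP-> /eqP->.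
have disjFG C D : C \in F -> D \in G -> v \in inner C -> v \in inner D -> False.
  move=> /(dissection_setI_sub dF)/innerS/subsetP sC.
  move=> /(dissection_setI_sub dG)/innerS/subsetP sD /sC vij /sD.
  exact: inner_cyc_itv_disjoint.
rewrite !in_setU => /orP[AF|AG] /orP[BF|BG] vA vB.
- exact: IHF.
- by case: (disjFG A B).
- by case: (disjFG B A).
- exact: IHG.
Qed.

Lemma card_bigcup_inner F : disjoint_inner F ->
  #|\bigcup_(A in F) inner A| = \sum_(A in F) #|inner A|.
Proof.
move=> disjF; rewrite -sum1_card [\bigcup_(A in F) _]big_mkcond.
rewrite partition_disjoint_bigcup => [|A B AB].
  rewrite [RHS]big_mkcond; apply: eq_bigr => A _.
  by case: ifP => _; rewrite ?big_set0 ?sum1_card.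
rewrite -setI_eq0; apply/eqP/setP => v; rewrite in_setI in_set0.
apply/negP => /andP[]; case: ifP => [AF|]; last by rewrite in_set0.
case: ifP => [BF vA vB|]; last by rewrite in_set0.
by rewrite (disjF v A B) ?eqxx in AB.
Qed.

(* A triangle has one inner vertex, and a degenerate polygon has none. *)
Lemma card_triangles F : disjoint_inner F -> (forall t, t \in F -> #|t| <= 3) ->
  #|triangles F| = #|\bigcup_(t in F) inner t|.
Proof.
move=> disjF cardF; rewrite card_bigcup_inner // -sum1dep_card big_mkcondr.
by apply: eq_bigr => t /cardF card_t; rewrite card_inner; case: eqP; lia.
Qed.

Lemma bigcup_inner_side T i j : chord_avoids T i j -> i != j ->
  \bigcup_(t in [set t in T | t \subset cyc_itv i j]) inner t =
  \bigcup_(t in T) inner t :&: inner (cyc_itv i j).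
Proof.
move=> avoid ij; apply/setP => v; rewrite in_setI; apply/bigcupP/andP.
  case=> t /setIdP[tT tij] vt; split; first by apply/bigcupP; exists t.
  exact: subsetP (innerS tij) _ vt.
case=> /bigcupP[t tT vt] vij; exists t => //; rewrite inE tT.
have [//|/innerS/subsetP tji] := avoid t tT.
by case: (inner_cyc_itv_disjoint ij vij (tji v vt)).
Qed.

Section Refinement.
Variables (F : {set {set 'I_n}}) (G : {set 'I_n} -> {set {set 'I_n}}).
Hypothesis dissectionG : forall A, A \in F -> dissection A (G A).

Lemma bigcup_inner_refinement :
  \bigcup_(B in \bigcup_(A in F) G A) inner B = \bigcup_(A in F) inner A.
Proof.
apply/setP => v; apply/bigcupP/bigcupP => [[B /bigcupP[A AF BGA] vB]|[A AF]].
  exists A => //; apply: subsetP vB.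
  exact/innerS/(dissection_sub (dissectionG AF)).
rewrite -(bigcup_inner_dissection (dissectionG AF)) => /bigcupP[B BGA vB].
by exists B => //; apply/bigcupP; exists A.
Qed.

Lemma disjoint_inner_refinement :
  disjoint_inner F -> disjoint_inner (\bigcup_(A in F) G A).
Proof.
move=> disjF v B B' /bigcupP[A AF BGA] /bigcupP[A' AF' BGA'] vB vB'.
have inner_sub C D : C \in F -> D \in G C -> v \in inner D -> v \in inner C.
  by move=> /dissectionG dC /(dissection_sub dC)/innerS/subsetP; apply.
have eqA : A = A'.
  by apply: (disjF v) => //; [exact: inner_sub vB|exact: inner_sub vB'].
by subst A'; exact: (dissection_disjoint_inner (dissectionG AF)) vB vB'.
Qed.

End Refinement.

Lemma dissection_noncrossing S F A B i j : dissection S F ->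
    A \in F -> B \in F -> A != B -> i != j -> i \in A -> j \in A ->
  B \subset cyc_itv i j \/ B \subset cyc_itv j i.
Proof.
move=> dF + + + ij; have separated p q X Y : p != q ->
    X \subset cyc_itv p q -> Y \subset cyc_itv q p -> i \in X -> j \in X ->
    Y \subset cyc_itv i j \/ Y \subset cyc_itv j i.
  move=> pq /subsetP sX sY /sX iX /sX jX.
  by have [s|s] := cyc_itv_noncrossing pq ij iX jX; [left|right];
    exact: subset_trans s.
elim: dF A B => {S F} [S _ A B|S p q F G pS qS pq _ _ dF IHF dG IHG A B].
  by rewrite !in_set1 => /eqP-> /eqP->; rewrite eqxx.
have sF := dissection_setI_sub dF; have sG := dissection_setI_sub dG.
rewrite !in_setU => /orP[AF|AG] /orP[BF|BG] AB iA jA.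
- exact: (IHF A).
- exact: separated pq (sF _ AF) (sG _ BG) iA jA.
- by rewrite eq_sym in pq; exact: separated pq (sG _ AG) (sF _ BF) iA jA.
- exact: (IHG A).
Qed.

End Dissections.

Section Triangulations.
Import boot.fintype boot.finset.
Local Open Scope set_scope.
Context {n : nat}.
Implicit Types (i j : 'I_n) (S t : {set 'I_n}) (T U : {set {set 'I_n}}).

Lemma triangulation_cut S i j T U : i \in S -> j \in S -> i != j ->
    2 < #|S :&: cyc_itv i j| -> 2 < #|S :&: cyc_itv j i| ->
    triangulation (S :&: cyc_itv i j) T ->
    triangulation (S :&: cyc_itv j i) U ->
  triangulation S (T :|: U).
Proof.
move=> iS jS ij card_ij card_ji [dT cardT] [dU cardU].
split; first exact: (dissection_cut iS jS).
by move=> t; rewrite in_setU => /orP[/cardT|/cardU].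
Qed.

Lemma card_cut S i j : i \in S -> j \in S -> i != j ->
  #|S :&: cyc_itv i j| + #|S :&: cyc_itv j i| = #|S| + 2.
Proof.
move=> iS jS ij; rewrite -cardsUI -setIUr cyc_itvUC // setIT.
rewrite setIACA setIid cyc_itvIC // (setIidPr _) ?cards2 ?ij //.
by apply/subsetP => v; rewrite in_set2 => /orP[] /eqP->.
Qed.

Lemma exists_diagonal S : 3 < #|S| -> exists i j,
  [/\ i \in S, j \in S, i != j, 2 < #|S :&: cyc_itv i j|
    & 2 < #|S :&: cyc_itv j i|].
Proof.
move=> cardS; have /card_gt1P[u [v [uS vS]]] : 1 < #|inner S|.
  by rewrite card_inner; lia.
wlog uv : u v uS vS / u < v => [hwlog nequv|_].
  have [uv|vu|/val_inj equv] := ltngtP u v; first exact: (hwlog u v).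
    by apply: (hwlog v u); rewrite // eq_sym.
  by rewrite equv eqxx in nequv.
have /innerP[{}uS [a aS au] _] := uS; have /innerP[{}vS _ [c cS vc]] := vS.
have av := ltn_trans au uv; have neqav : a != v by rewrite -val_eqE /= ltn_eqF.
exists a, v; split=> //.
  have : 0 < #|inner (S :&: cyc_itv a v)|.
    by apply/card_gt0P; exists u; rewrite in_inner_cut // uS au.
  by rewrite card_inner; lia.
have : #|S :&: cyc_itv a v| < #|S|.
  apply/proper_card/properP; split; first exact: subsetIl.
  by exists c; rewrite // in_setI in_cyc_itv; lia.
by have := card_cut aS vS neqav; lia.
Qed.

Lemma triangulation_exists S : 1 < #|S| -> exists T, triangulation S T.
Proof.
have [m] := ubnP #|S|; elim: m S => // m IH S cardS_lt S_gt1.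
have [small_S|/exists_diagonal] := leqP #|S| 3.
  exists [set S]; split; first exact: dissection_whole.
  by move=> t; rewrite in_set1 => /eqP->.
case=> i [j [iS jS ij card_ij card_ji]]; have cut_cardS := card_cut iS jS ij.
have [||T triT] := IH (S :&: cyc_itv i j); [by lia|exact: ltnW|].
have [||U triU] := IH (S :&: cyc_itv j i); [by lia|exact: ltnW|].
by exists (T :|: U); exact: (triangulation_cut iS jS).
Qed.

Lemma triangulation_avoiding S i j : i \in S -> j \in S -> i != j ->
  exists2 T, triangulation S T & chord_avoids T i j.
Proof.
move=> iS jS ij; have cut_cardS := card_cut iS jS ij.
have [T triT] : exists T, triangulation S T.
  by apply: triangulation_exists; apply/card_gt1P; exists i, j.
have one_side p q : #|S| <= #|S :&: cyc_itv p q| ->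
    forall t, t \in T -> t \subset cyc_itv p q.
  move=> card_pq t /(dissection_sub triT.1) /subset_trans; apply.
  by apply/setIidPl/eqP; rewrite eqEcard subsetIl.
have [small_side|card_ij] := leqP #|S :&: cyc_itv i j| 2.
  by exists T => // t tT; right; apply: one_side tT; lia.
have [small_side|card_ji] := leqP #|S :&: cyc_itv j i| 2.
  by exists T => // t tT; left; apply: one_side tT; lia.
have [U triU] := triangulation_exists (ltnW card_ij).
have [V triV] := triangulation_exists (ltnW card_ji).
exists (U :|: V); first exact: (triangulation_cut iS jS).
move=> t; rewrite in_setU => /orP[tU|tV].
  by left; exact: dissection_setI_sub triU.1 tU.
by right; exact: dissection_setI_sub triV.1 tV.
Qed.

End Triangulations.

Section VertexAreas.
Import boot.fintype boot.finset.
Local Open Scope set_scope.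
Context {n : nat}.
Implicit Types (i j v : 'I_n) (S : {set 'I_n}).

Definition vertex_area S i j : nat := #|S :&: inner (cyc_itv i j)|.

Lemma vertex_area_sum S i j : i < j ->
  vertex_area S i j = \sum_(v in S) (i < v < j).
Proof.
move=> ij; rewrite /vertex_area -sum1_card big_mkcond [RHS]big_mkcond.
apply: eq_bigr => v _; rewrite in_setI in_inner_cyc_itv //.
by case: (v \in S); case: (_ < _ < _).
Qed.

Lemma sum_eq_mem S j : \sum_(v in S) (v == j) = (j \in S).
Proof.
rewrite (big_setID [set j]) /= [X in _ + X]big1 ?addn0 => [|v]; last first.
  by rewrite in_setD in_set1 => /andP[/negPf-> _].
have [jS|jS] := boolP (j \in S).
  by rewrite (setIidPr _) ?sub1set // big_set1 eqxx.
by rewrite disjoint_setI0 ?big_set0 // disjoint_sym disjoints1.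
Qed.

Lemma vertex_area_split S i v j : i < v -> v < j ->
  vertex_area S i j = vertex_area S i v + vertex_area S v j + (v \in S).
Proof.
move=> iv vj; rewrite -sum_eq_mem !vertex_area_sum //; last exact: ltn_trans vj.
rewrite -!big_split /=; apply: eq_bigr => u _.
by rewrite -val_eqE /=; lia.
Qed.

Lemma vertex_area_compl S i j : S \subset inner [set: 'I_n] -> i != j ->
  vertex_area S i j + vertex_area S j i = #|S|.
Proof.
move=> /setIidPl SE ij.
rewrite /vertex_area [inner (cyc_itv j i)]inner_cyc_itvC //.
by rewrite setIDA SE cardsID.
Qed.

Lemma vertex_area_ordS S i : vertex_area S i (ordS i) = 0.
Proof. by rewrite /vertex_area inner_cyc_itv_ordS setI0 cards0. Qed.

End VertexAreas.

Section BlackInner.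
Import boot.fintype boot.finset.
Local Open Scope set_scope.
Context {n : nat} (sigma : bicolored_subdivision n).
Implicit Types (i j v : 'I_n) (S A B t : {set 'I_n}) (T : {set {set 'I_n}}).

Definition black_inner : {set 'I_n} := \bigcup_(B in black sigma) inner B.

Lemma black_inner_sub : black_inner \subset inner [set: 'I_n].
Proof. by apply/bigcupsP => B _; apply/innerS/subsetT. Qed.

Lemma black_sub : black sigma \subset black sigma :|: white sigma.
Proof. exact: subsetUl. Qed.

Lemma black_disjoint_inner : disjoint_inner (black sigma).
Proof.
move=> v A B /(subsetP black_sub) Asigma /(subsetP black_sub) Bsigma.
exact: (dissection_disjoint_inner (bicolored_dissection sigma)).
Qed.

Lemma card_black_polygon B : B \in black sigma -> 1 < #|B|.
Proof.
move=> /(subsetP black_sub).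
exact: dissection_card (bicolored_dissection sigma).
Qed.

Lemma bigcup_inner_black_triangulation T : black_triangulation sigma T ->
  \bigcup_(t in T) inner t = black_inner.
Proof.
by case=> tr tri_tr ->; apply: bigcup_inner_refinement => B /tri_tr[].
Qed.

Lemma black_triangulation_disjoint_inner T : black_triangulation sigma T ->
  disjoint_inner T.
Proof.
case=> tr tri_tr ->; apply: disjoint_inner_refinement black_disjoint_inner.
by move=> B /tri_tr[].
Qed.

Lemma black_triangulation_card T t : black_triangulation sigma T -> t \in T ->
  #|t| <= 3.
Proof. by case=> tr tri_tr -> /bigcupP[B /tri_tr[_ card_tr] /card_tr]. Qed.

Lemma card_black_triangles T : black_triangulation sigma T ->
  #|triangles T| = #|black_inner|.
Proof.
move=> triT; rewrite -(bigcup_inner_black_triangulation triT) card_triangles //.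
  exact: black_triangulation_disjoint_inner.
by move=> t; exact: black_triangulation_card.
Qed.

Lemma card_black_triangles_left T i j : black_triangulation sigma T ->
    chord_avoids T i j -> i != j ->
  #|[set t in triangles T | t \subset cyc_itv i j]| =
    vertex_area black_inner i j.
Proof.
move=> triT avoid ij; rewrite /vertex_area.
rewrite -(bigcup_inner_black_triangulation triT) -bigcup_inner_side //.
rewrite -card_triangles.
- by apply: eq_card => t; rewrite !inE andbAC.
- move=> v A B /setIdP[AT _] /setIdP[BT _].
  exact: black_triangulation_disjoint_inner triT _ _ _ AT BT.
- by move=> t /setIdP[tT _]; exact: black_triangulation_card tT.
Qed.

Lemma black_triangulation_exists (P : {set 'I_n} -> Prop) :
    (forall B, B \in black sigma ->
      exists2 T, triangulation B T & forall t, t \in T -> P t) ->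
  exists2 T, black_triangulation sigma T & forall t, t \in T -> P t.
Proof.
move=> exT.
have /choice[tr trP] B : exists T, B \in black sigma ->
    triangulation B T /\ forall t, t \in T -> P t.
  by have [/exT[T]|_] := boolP (B \in black sigma); [exists T|exists set0].
exists (\bigcup_(B in black sigma) tr B); first by exists tr => // B /trP[].
by move=> t /bigcupP[B /trP[_ PtrB]]; exact: PtrB.
Qed.

Lemma black_triangulation_avoiding i j : compatible_arc sigma i j ->
  exists2 T, black_triangulation sigma T & chord_avoids T i j.
Proof.
case=> ij [A Asigma [iA jA]]; apply: black_triangulation_exists => B Bblack.
have [<-|AB] := eqVneq A B; first exact: triangulation_avoiding.
have [T triT] := triangulation_exists (card_black_polygon Bblack).
have Bsigma := subsetP black_sub _ Bblack.
exists T => // t /(dissection_sub triT.1) tB.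
have dsigma := bicolored_dissection sigma.
by case: (dissection_noncrossing dsigma Asigma Bsigma AB ij iA jA) => sB;
  [left|right]; exact: subset_trans sB.
Qed.

Lemma card_black_inner k : has_type sigma k -> #|black_inner| = k.
Proof.
move=> type_k; have [|T triT _] := @black_triangulation_exists (fun=> True).
  by move=> B /card_black_polygon/triangulation_exists[T triT]; exists T.
by rewrite -(type_k T triT) (card_black_triangles triT).
Qed.

Lemma black_inner_subsets k : has_type sigma k ->
  black_inner \in inner_subsets k.
Proof.
move=> type_k; apply/inner_subsetsP; split; first exact: black_inner_sub.
exact: card_black_inner.
Qed.

Lemma is_areaP i j a : compatible_arc sigma i j ->
  is_area sigma i j a <-> a = vertex_area black_inner i j.
Proof.
move=> comp; have ij := comp.1; split=> [areaT|-> T triT avoid].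
  have [T triT avoid] := black_triangulation_avoiding comp.
  by rewrite -(areaT T triT avoid) card_black_triangles_left.
exact: card_black_triangles_left.
Qed.

(* A vertex v between two others, a < v < c, of a polygon of sigma is in S iff
   the area of a -> c exceeds the sum of the areas of a -> v and v -> c. *)
Lemma black_inner_unique S : S \subset inner [set: 'I_n] ->
    (forall i j, compatible_arc sigma i j ->
      vertex_area S i j = vertex_area black_inner i j) ->
  S = black_inner.
Proof.
move=> Ssub eq_area; apply/setP => v.
have [vin|vout] := boolP (v \in inner [set: 'I_n]); last first.
  rewrite (contraNF (subsetP Ssub v)) //.
  by rewrite (contraNF (subsetP black_inner_sub v)).
move: vin; rewrite -(bigcup_inner_dissection (bicolored_dissection sigma)).
case/bigcupP=> A Asigma /innerP[vA [a aA av] [c cA vc]].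
have comp x y : x \in A -> y \in A -> x < y -> compatible_arc sigma x y.
  by move=> xA yA xy; split; [rewrite -val_eqE /= ltn_eqF|exists A].
have := eq_area _ _ (comp _ _ aA cA (ltn_trans av vc)).
rewrite !(vertex_area_split _ av vc) (eq_area _ _ (comp _ _ aA vA av)).
rewrite (eq_area _ _ (comp _ _ vA cA vc)).
by move/addnI; do 2?case: (_ \in _).
Qed.

End BlackInner.

Local Open Scope ring_scope.

Section HypersimplexBox.
Import boot.fintype boot.finset.
Local Open Scope set_scope.
Context {R : realType} {n : nat}.
Implicit Types (x y : 'rV[R]_n) (i j l : 'I_n) (I : {set 'I_n}) (m : nat).

Lemma hypersimplex_convex m x y (a b : R) : 0 <= a -> 0 <= b -> a + b = 1 ->
  hypersimplex m x -> hypersimplex m y -> hypersimplex m (a *: x + b *: y).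
Proof.
move=> a_ge0 b_ge0 ab1 [w [w_ge0 w_sum ->]] [u [u_ge0 u_sum ->]].
exists (fun I => a * w I + b * u I); split.
- by move=> I cardI; rewrite addr_ge0 // mulr_ge0 ?w_ge0 ?u_ge0.
- by rewrite big_split /= -!mulr_sumr w_sum u_sum !mulr1.
- rewrite !scaler_sumr -big_split /=; apply: eq_bigr => I _.
  by rewrite !scalerA scalerDl.
Qed.

Lemma hypersimplex_indicator_vec I :
  hypersimplex #|I| (indicator_vec I : 'rV[R]_n).
Proof.
exists (fun J => (J == I)%:R); split; first by move=> J _; rewrite ler0n.
  by rewrite (bigD1 I) //= eqxx big1 ?addr0 // => J /andP[_ /negPf->].
rewrite (bigD1 I) //= eqxx scale1r big1 ?addr0 // => J /andP[_ /negPf->].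
by rewrite scale0r.
Qed.

Lemma coord_sum_indicator_vec I :
  coord_sum (indicator_vec I : 'rV[R]_n) [set: 'I_n] = #|I|%:R.
Proof.
rewrite /coord_sum -sum1_card natr_sum [RHS]big_mkcond.
apply: eq_big => [l|l _]; first by rewrite in_setT.
by rewrite mxE; case: (l \in I).
Qed.

Definition in_box x : Prop := forall i, 0 <= x ord0 i <= 1.

Definition fractional x : {set 'I_n} := [set i | 0 < x ord0 i < 1].

Lemma in_box_integral x i : in_box x -> i \notin fractional x ->
  x ord0 i = (x ord0 i == 1)%:R.
Proof.
move=> /(_ i)/andP[+ +]; rewrite inE !le_eqVlt => /predU1P[<- _|->].
  by rewrite eq_sym oner_eq0.
by case/predU1P=> [->|->]; rewrite ?eqxx.
Qed.

Lemma in_box_indicator_vec x : in_box x -> fractional x = set0 ->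
  x = indicator_vec [set l | x ord0 l == 1].
Proof.
move=> xbox frac0; apply/rowP => l; rewrite mxE inE.
by apply: in_box_integral; rewrite // frac0 in_set0.
Qed.

Lemma exists_fractional_neq x m i : in_box x ->
    coord_sum x [set: 'I_n] = m%:R -> i \in fractional x ->
  exists2 j, j \in fractional x & j != i.
Proof.
move=> xbox xsum ifrac; have [/exists_inP//|/exists_inPn only_i] :=
  boolP [exists j in fractional x, j != i].
suff /intrP[z xiz] : x ord0 i \is a Num.int.
  by move: ifrac; rewrite inE xiz ltr0z ltrz1; lia.
have -> : x ord0 i = m%:R - \sum_(l | l != i) x ord0 l.
  rewrite -xsum /coord_sum (bigD1 i) ?in_setT //=.
  by rewrite (eq_bigl (fun l => l != i)) ?addrK // => l; rewrite in_setT.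
rewrite rpredB ?rpred_nat // rpred_sum // => l li.
rewrite (@in_box_integral _ l) ?rpred_nat //.
by apply: contraTN li => /only_i.
Qed.

Definition transfer x i j (a : R) : 'rV[R]_n :=
  x + a *: (indicator_vec [set i] - indicator_vec [set j]).

Lemma coord_sum_transfer x i j a :
  coord_sum (transfer x i j a) [set: 'I_n] = coord_sum x [set: 'I_n].
Proof.
have := coord_sum_indicator_vec [set j].
have := coord_sum_indicator_vec [set i].
rewrite !cards1 /coord_sum => sumi sumj.
rewrite (eq_bigr (fun l => x ord0 l +
    a * (indicator_vec [set i] ord0 l - indicator_vec [set j] ord0 l))).
  by rewrite big_split /= -mulr_sumr sumrB sumi sumj subrr mulr0 addr0.
by move=> l _; rewrite !mxE.
Qed.

Lemma transfer_fractional x i j : in_box x -> i != j ->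
    i \in fractional x -> j \in fractional x ->
  exists2 a, 0 < a & in_box (transfer x i j a) /\
    (#|fractional (transfer x i j a)| < #|fractional x|)%N.
Proof.
move=> xbox ij ifrac jfrac.
have /andP[xi_gt0 xi_lt1] : 0 < x ord0 i < 1 by rewrite inE in ifrac.
have /andP[xj_gt0 xj_lt1] : 0 < x ord0 j < 1 by rewrite inE in jfrac.
pose a := Num.min (1 - x ord0 i) (x ord0 j).
have [a_gt0 a_le_i a_le_j] : [/\ 0 < a, a <= 1 - x ord0 i & a <= x ord0 j].
  by rewrite lt_min !ge_min !lexx orbT; split=> //; lra.
have transferE l : transfer x i j a ord0 l =
    if l == i then x ord0 i + a else if l == j then x ord0 j - a else x ord0 l.
  rewrite !mxE !in_set1; case: eqVneq => [->|_].
    by rewrite (negPf ij) subr0 mulr1.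
  by case: eqVneq => [->|_] /=; ring.
exists a => //; split=> [l|].
  rewrite transferE; case: eqVneq => _; first lra.
  by case: eqVneq => _; [lra|exact: xbox].
apply/proper_card/properP; split.
  apply/subsetP => l; rewrite inE transferE; case: eqVneq => [-> _ //|_].
  by case: eqVneq => [-> _ //|_]; rewrite inE.
have [a_eq_i|a_eq_j] : a = 1 - x ord0 i \/ a = x ord0 j.
    by rewrite /a; case: leP; auto.
  by exists i => //; rewrite inE transferE eqxx a_eq_i addrC subrK ltxx andbF.
exists j => //; rewrite inE transferE eqxx eq_sym (negPf ij) a_eq_j subrr.
by rewrite ltxx.
Qed.

(* If x has a fractional coordinate, then it has two, i and j, and x lies
   strictly between two points with fewer fractional coordinates on the line
   directed by e_i - e_j. *)
Lemma hypersimplex_box m x : in_box x -> coord_sum x [set: 'I_n] = m%:R ->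
  hypersimplex m x.
Proof.
have [N] := ubnP #|fractional x|; elim: N x => // N IH x fracx xbox xsum.
have [frac0|[i ifrac]] := set_0Vmem (fractional x).
  have xE := in_box_indicator_vec xbox frac0.
  move: xsum; rewrite xE coord_sum_indicator_vec => /eqP.
  by rewrite eqr_nat => /eqP <-; exact: hypersimplex_indicator_vec.
have [j jfrac ji] := exists_fractional_neq xbox xsum ifrac.
have ij : i != j by rewrite eq_sym.
have [a a_gt0 [abox fraca]] := transfer_fractional xbox ij ifrac jfrac.
have [b b_gt0 [bbox fracb]] := transfer_fractional xbox ji jfrac ifrac.
have ab_neq0 : a + b != 0 by rewrite gt_eqF // addr_gt0.
have -> : x =
    (b / (a + b)) *: transfer x i j a + (a / (a + b)) *: transfer x j i b.
  by apply/rowP => l; rewrite !mxE; field.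
apply: hypersimplex_convex; rewrite ?divr_ge0 ?addr_ge0 ?ltW //; first by field.
- by apply: IH; rewrite ?coord_sum_transfer //; exact: leq_trans fraca _.
- by apply: IH; rewrite ?coord_sum_transfer //; exact: leq_trans fracb _.
Qed.

End HypersimplexBox.

Local Open Scope classical_set_scope.

Section ArcSlabs.
Import boot.fintype boot.finset.
Local Open Scope set_scope.
Context {R : realType} {n : nat}.
Implicit Types (x : 'rV[R]_n) (i j : 'I_n) (S : {set 'I_n}).

Lemma coord_sum_setC x S :
  coord_sum x (~: S) = coord_sum x [set: 'I_n] - coord_sum x S.
Proof.
rewrite /coord_sum [X in _ = X - _](big_setID S) /= setTI setTD.
by rewrite addrAC subrr add0r.
Qed.

Lemma coord_sum_continuous S : continuous (fun x : 'rV[R]_n => coord_sum x S).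
Proof.
move=> x; apply: cvg_big => [||l _]; first exact: add_continuous.
  exact: nbhs_filter.
exact: coord_continuous.
Qed.

Definition arc_slab S i j : set 'rV[R]_n :=
  [set x | (vertex_area S i j)%:R < coord_sum x (cyc_itv i (ord_pred j))
           < (vertex_area S i j)%:R + 1]%classic.

Lemma open_arc_slab S i j : open (arc_slab S i j).
Proof.
have -> : arc_slab S i j = (fun x => coord_sum x (cyc_itv i (ord_pred j))) @^-1`
    `](vertex_area S i j)%:R, (vertex_area S i j)%:R + 1[.
  by apply/seteqP; split=> x; rewrite /= in_itv.
apply: open_comp => [x _|]; first exact: coord_sum_continuous.
exact: interval_open.
Qed.

End ArcSlabs.

Section TestPoints.
Import boot.fintype boot.finset.
Local Open Scope set_scope.
Context {R : realType} {n : nat}.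
Implicit Types (x : 'rV[R]_n) (i j : 'I_n) (S : {set 'I_n}) (m k : nat).

Definition increments (f : nat -> R) : 'rV[R]_n := \row_l (f l.+1 - f l).

Lemma coord_sum_increments f :
  coord_sum (increments f) [set: 'I_n] = f n - f 0%N.
Proof.
rewrite -(telescope_sumr f (leq0n n)) big_mkord.
by apply: eq_big => l; rewrite ?in_setT // mxE.
Qed.

Lemma coord_sum_increments_itv f i j : (i < j)%N ->
  coord_sum (increments f) (cyc_itv i (ord_pred j)) = f j - f i.
Proof.
move=> ij; rewrite -(telescope_sumr f (ltnW ij)) big_geq_mkord.
rewrite (big_ord_widen_cond n (fun m => true && (i <= m)%N)
  (fun m => f m.+1 - f m)) ?(ltnW (ltn_ord j)) //.
by apply: eq_big => l; rewrite ?mxE // in_cyc_itv_pred.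
Qed.

(* Every offset is further from 0 than all the previous ones: below them on S,
   above them elsewhere, and always by less than 1. *)
Definition offset S m : R :=
  (-1) ^+ (m \in [seq val v | v in S]) * (m%:R / (2 * n)%:R).

Lemma offset_sub_bounds S i j : (i < j)%N ->
  0 < offset S j - offset S i + (j \in S)%:R < 1.
Proof.
move=> ij; rewrite /offset !(mem_image val_inj).
have n2_gt0 : 0 < (2 * n)%:R :> R by rewrite ltr0n; have := ltn_ord j; lia.
set u : R := i%:R / _; set v : R := j%:R / _.
have u_ge0 : 0 <= u by rewrite divr_ge0 ?ler0n.
have uv : u < v by rewrite ltr_pM2r ?invr_gt0 // ltr_nat.
have v_lt : v < 2^-1.
  by rewrite ltr_pdivrMr // natrM mulKf ?ltr_nat ?ltn_ord // pnatr_eq0.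
by case: (j \in S); case: (i \in S); rewrite /= ?expr0 ?expr1; lra.
Qed.

Definition height S m : R := (\sum_(v in S) (v <= m)%N)%:R + offset S m.

Lemma height_sub_bounds S i j : (i < j)%N ->
  (vertex_area S i j)%:R < height S j - height S i
    < (vertex_area S i j)%:R + 1.
Proof.
move=> ij; have -> : height S j - height S i =
    (vertex_area S i j)%:R + (offset S j - offset S i + (j \in S)%:R).
  suff countE : (\sum_(v in S) (v <= j) =
      \sum_(v in S) (v <= i) + vertex_area S i j + (j \in S))%N.
    by rewrite /height countE !natrD; ring.
  rewrite vertex_area_sum // -sum_eq_mem -!big_split /=.
  by apply: eq_bigr => v _; rewrite -val_eqE /=; lia.
by have := offset_sub_bounds S ij; lra.
Qed.

Definition test_point k S : 'rV[R]_n :=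
  increments (fun m => if m == n then height S 0 + k.+1%:R else height S m).

Lemma coord_sum_test_point k S : (0 < n)%N ->
  coord_sum (test_point k S) [set: 'I_n] = k.+1%:R.
Proof.
move=> n_gt0; rewrite coord_sum_increments eqxx eq_sym gtn_eqF //.
by rewrite addrC addKr.
Qed.

Lemma arc_slab_test_point k S i j : S \in inner_subsets k -> i != j ->
  arc_slab S i j (test_point k S).
Proof.
move=> /inner_subsetsP[Ssub Sk] ij; have forward (p q : 'I_n) : (p < q)%N ->
    arc_slab S p q (test_point k S).
  move=> pq; rewrite /arc_slab /= coord_sum_increments_itv // !ltn_eqF //.
  exact: height_sub_bounds.
have [|ji|/val_inj eqij] := ltngtP i j; first exact: forward.
  have n_gt0 : (0 < n)%N := leq_ltn_trans (leq0n i) (ltn_ord i).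
  rewrite /arc_slab /= cyc_itv_predC 1?eq_sym //.
  rewrite coord_sum_setC coord_sum_test_point //.
  have /(congr1 (fun m => m%:R : R)) := vertex_area_compl Ssub ij.
  by have := forward _ _ ji; rewrite /arc_slab /= Sk natrD -natr1; lra.
by rewrite eqij eqxx in ij.
Qed.

Lemma hypersimplex_test_point k S : (1 < n)%N -> S \in inner_subsets k ->
  hypersimplex k.+1 (test_point k S).
Proof.
move=> n_gt1 Sk; apply: hypersimplex_box; last first.
  by apply: coord_sum_test_point; lia.
move=> i; have := arc_slab_test_point Sk (neq_ordS i n_gt1).
rewrite /arc_slab /= ordSK cyc_itvxx vertex_area_ordS /coord_sum big_set1 add0r.
by case/andP=> /ltW-> /ltW->.
Qed.

Lemma tile_test_point_eq k sigma S : S \in inner_subsets k ->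
  tile k sigma (test_point k S) -> S = black_inner sigma.
Proof.
move=> Sk [_ in_tile]; have [Ssub _] := inner_subsetsP _ _ Sk.
apply: (black_inner_unique Ssub) => i j comp.
have := in_tile i j _ comp ((is_areaP _ comp).2 erefl).
have := arc_slab_test_point Sk comp.1; rewrite /arc_slab /=.
move: (coord_sum _ _) => c /andP[lo up] /andP[lo' up'].
apply/eqP; rewrite eqn_leq; apply/andP.
by split; rewrite -ltnS -(ltr_nat R) -natr1; lra.
Qed.

Lemma tile_interior_test_point k sigma : (0 < n)%N -> has_type sigma k ->
  tile_interior k (tile k sigma) (test_point k (black_inner sigma)).
Proof.
move=> n_gt0 type_k; split; first exact: coord_sum_test_point.
have Sk := black_inner_subsets type_k.
have near_slab i j : \forall x \near test_point k (black_inner sigma),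
    i != j -> arc_slab (black_inner sigma) i j x.
  have [->|ij] := eqVneq i j; first by apply: (filterE (nbhs_filter _)).
  have slab := arc_slab_test_point Sk ij.
  have nbhs_slab := open_nbhs_nbhs (conj (@open_arc_slab R n _ i j) slab).
  by apply: filterS nbhs_slab => x.
have := filter_forall (nbhs_filter _)
  (fun i => filter_forall (nbhs_filter _) (near_slab i)).
apply: filterS => x xslab xsum; split=> // i j a comp /(is_areaP _ comp) ->.
by have /andP[/ltW-> /ltW->] := xslab i j comp.1.
Qed.

End TestPoints.

Theorem theorem5p10 (R : realType) (k n : nat) (hk : (k + 2 <= n)%N)
    (T : set (set 'rV[R]_n)) (hT : positroid_tiling k T) :
  (T #= `I_('C(n - 2, k)))%card.
Proof.
have n_gt1 : (1 < n)%N by lia.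
case: hT => tiles triv cover.
rewrite -card_inner_subsets.
apply: (card_eq_transversal (p := test_point k) triv).
- move=> G /tiles[sigma type_k ->]; exists (black_inner sigma); split.
  + exact: black_inner_subsets.
  + exact: tile_interior_test_point (ltnW n_gt1) type_k.
  + by move=> S; exact: tile_test_point_eq.
- move=> S /(hypersimplex_test_point (R := R) n_gt1).
  by rewrite -cover => -[G TG Gp]; exists G.
Qed.
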